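(* Let $f\colon\mathbb{R}^m\to\mathbb{R}$ be any polytopic function and let $\mathcal{M}\subseteq\mathbb{R}^m$ be a smooth embedded submanifold. If $x\in\mathcal{M}$ is the unique minimizer of $f(z)$ subject to $z-x\in T_x\mathcal{M}$, then $x$ is also a strong local minimizer of $f(z)$ subject to $z\in\mathcal{M}$.
   Context: A function $f\colon\mathbb{R}^m\to\mathbb{R}$ is polytopic if for every $t\in\mathbb{R}$ the sublevel set $\{z\in\mathbb{R}^m:f(z)\le t\}$ is a finite intersection of closed halfspaces. $T_x\mathcal{M}\subseteq\mathbb{R}^m$ denotes the tangent space of $\mathcal{M}$ at $x$, viewed as a linear subspace of $\mathbb{R}^m$. A point $x\in\mathcal{M}$ is a strong local minimizer of $f$ in $\mathcal{M}$ if there is a neighborhood $\mathcal{N}_x$ of $x$ (in $\mathbb{R}^m$) such that every $y\in\mathcal{M}\cap\mathcal{N}_x\setminus\{x\}$ satisfies $f(y)>f(x)$. *)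

(* Defs.v *)
From mathcomp Require Import all_boot all_order all_algebra.
From mathcomp Require Import all_classical all_reals all_analysis.

Set Implicit Arguments.
Unset Strict Implicit.
Unset Printing Implicit Defensive.

Import Order.TTheory GRing.Theory Num.Theory.
Import numFieldNormedType.Exports.

Local Open Scope classical_set_scope.
Local Open Scope ring_scope.

(* R^m is 'rV[R]_m. Its library norm is the sup norm, but only its topology and
   its differential calculus are used below, and neither depends on the norm. *)

(* A zero normal vector would give the whole space or the empty set, hence the
   requirement a != 0. *)
Definition closed_halfspace (R : realType) (m : nat) (H : set 'rV[R]_m) :=
  exists (a : 'rV[R]_m) (b : R),
    a != 0 /\ H = [set z | \sum_(i < m) a ord0 i * z ord0 i <= b].

(* k = 0 is allowed: the empty intersection is the whole space. *)
Definition finite_intersection_of_halfspaces (R : realType) (m : nat)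
    (P : set 'rV[R]_m) :=
  exists (k : nat) (H : 'I_k -> set 'rV[R]_m),
    (forall i, closed_halfspace (H i)) /\ P = \bigcap_(i in [set: 'I_k]) H i.

Definition polytopic (R : realType) (m : nat) (f : 'rV[R]_m -> R) :=
  forall t : R, finite_intersection_of_halfspaces [set z | f z <= t].

(* f is C^k on U, for U open in a finite-dimensional space: C^0 is continuity,
   and C^(k+1) is differentiability together with C^k directional derivatives.
   Since U is open, values of f outside U are irrelevant. *)
Fixpoint Ck_on (R : realType) (V W : normedModType R) (k : nat) (U : set V)
    (f : V -> W) : Prop :=
  match k with
  | 0 => forall x, U x -> {for x, continuous f}
  | k'.+1 => (forall x, U x -> differentiable f x) /\
             (forall v : V, Ck_on k' U (fun x => 'D_v f x))
  end.

Definition smooth_on (R : realType) (V W : normedModType R) (U : set V)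
    (f : V -> W) : Prop :=
  forall k, Ck_on k U f.

(* Maps between open subsets are represented by total functions whose values
   outside these subsets are unconstrained. *)
Definition diffeomorphism (R : realType) (m : nat) (U V : set 'rV[R]_m)
    (phi psi : 'rV[R]_m -> 'rV[R]_m) :=
  [/\ open U /\ open V,
      (forall z, U z -> V (phi z) /\ psi (phi z) = z),
      (forall u, V u -> U (psi u) /\ phi (psi u) = u),
      smooth_on U phi & smooth_on V psi].

(* Smooth embedded submanifold of R^m, by local slice charts: near each of its
   points, M is straightened by an ambient diffeomorphism onto the linear slice
   {u | u_d = ... = u_(m-1) = 0}. The dimension d is the same at all points. *)
Definition embedded_submanifold (R : realType) (m : nat) (M : set 'rV[R]_m) :=
  exists2 d : nat, (d <= m)%N &
    forall x, M x ->
      exists (U V : set 'rV[R]_m) (phi psi : 'rV[R]_m -> 'rV[R]_m),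
        [/\ U x, diffeomorphism U V phi psi &
            forall z, U z ->
              (M z <-> forall i : 'I_m, (d <= i)%N -> phi z ord0 i = 0)].

(* The tangent space at x, as a subset of R^m: velocities at time 0 of smooth
   curves in M through x. *)
Definition tangent_space (R : realType) (m : nat) (M : set 'rV[R]_m)
    (x : 'rV[R]_m) : set 'rV[R]_m :=
  [set v | exists (e : R) (c : R -> 'rV[R]_m),
     [/\ 0 < e, smooth_on `]- e, e[ c, (forall t, t \in `]- e, e[ -> M (c t)),
         c 0 = x & derive1 c 0 = v]].

Definition minimizer (R : realType) (T : Type) (f : T -> R) (S : set T) (x : T) :=
  S x /\ forall z, S z -> f x <= f z.

Definition unique_minimizer (R : realType) (T : Type) (f : T -> R) (S : set T)
    (x : T) :=
  minimizer f S x /\ forall y, minimizer f S y -> y = x.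

Definition strong_local_minimizer (R : realType) (m : nat) (f : 'rV[R]_m -> R)
    (M : set 'rV[R]_m) (x : 'rV[R]_m) :=
  M x /\ exists2 N : set 'rV[R]_m, nbhs x N &
    forall y, M y -> N y -> y <> x -> f x < f y.

(* Main.v *)
Require Import Defs.
From mathcomp Require Import all_boot all_order all_algebra.
From mathcomp Require Import all_classical all_reals all_analysis.

Set Implicit Arguments.
Unset Strict Implicit.
Unset Printing Implicit Defensive.

Import Order.TTheory GRing.Theory Num.Theory.
Import numFieldNormedType.Exports.

Local Open Scope classical_set_scope.
Local Open Scope ring_scope.

(** Let P be the polyhedron {z | f z <= f x}, cut out by finitely many
    inequalities a_i . z <= b_i; the claim is that M meets P only at x near x.
    Let phi be a slice chart at x with inverse psi, let L be the linear slice
    and A the differential of psi at phi x.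

    For w in L, the direction A w is tangent to M, since t |-> psi (phi x + t w)
    is a smooth curve in M ([slice_direction_tangent]). If w is nonzero, some
    constraint active at x must increase along A w: otherwise a short step
    x + t A w would stay in P ([feasible_step]), hence be another minimizer on
    x + T_x M, contradicting uniqueness because A is injective
    ([diff_left_inverse]). So the total increase of the active constraints,
    [active_excess], is positive at A w for every nonzero w in L. Being
    continuous and positively homogeneous, it is at least delta |w| for some
    delta > 0, by compactness of the unit sphere of L
    ([positive_homogeneous_lower_bound]).

    Now let y in M be close to x, and put w = phi y - phi x, which lies in L.
    Then y = x + A w + r with r = o(|w|). If y belonged to P, no active
    constraint would increase from x to y, so the excess of A w would be due to
    the error r alone and be at most C |r| ([active_excess_le_error]). Hence
    delta |w| <= C |r|, which forces w = 0 and y = x. *)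

(** * Smooth maps along lines *)

(** The difference quotients on the two sides are the same function, so the
    identity needs no differentiability and holds at every t. This lets the
    induction in [Ck_on_line] replace one function by another globally. *)
Lemma derive_line (R : realType) (V W : normedModType R) (f : V -> W)
    (u w : V) (v t : R) :
  'D_v (fun s : R => f (u + s *: w)) t = 'D_(v *: w) f (u + t *: w).
Proof.
rewrite /derive; set q := (fun h : R => h^-1 *: _).
set q' := (fun h : R => h^-1 *: _).
suff -> : q = q' by [].
by apply/funext => h; rewrite /q /q' /= scalerDl scalerA addrCA.
Qed.

Lemma Ck_on_line (R : realType) (V W : normedModType R) (k : nat) (U : set V)
    (I : set R) (f : V -> W) (u w : V) :
  (forall t, I t -> U (u + t *: w)) -> Ck_on k U f ->
  Ck_on k I (fun t : R => f (u + t *: w)).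
Proof.
move=> IU; have dl (t : R) : differentiable (fun s : R => u + s *: w) t by [].
elim: k f => [|k IH] f /=.
  move=> fC t It; apply: (@continuous_comp _ _ _ (fun s : R => u + s *: w)).
    exact: differentiable_continuous.
  exact/fC/IU.
move=> [fd fD]; split=> [t It|v].
  by apply: (differentiable_comp (dl t)); apply/fd/IU.
rewrite (_ : (fun x => _) = (fun t : R => 'D_(v *: w) f (u + t *: w))).
  exact: IH (fD _).
by apply/funext => t; rewrite derive_line.
Qed.

(** * Differentials *)

Lemma diff_left_inverse (R : realType) (V W : normedModType R)
    (f : V -> W) (g : W -> V) (u w : V) :
  differentiable f u -> differentiable g (f u) ->
  (\forall z \near u, g (f z) = z) ->
  'd g (f u) ('d f u w) = w.
Proof.
move=> df dg gfK.
rewrite -[RHS](derive_id u w) -(near_eq_derive w gfK).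
rewrite -[RHS]/('D_w (g \o f) u) (deriveE w (differentiable_comp df dg)).
by rewrite (diff_comp df dg).
Qed.

Lemma smooth_differentiable (R : realType) (V W : normedModType R)
    (U : set V) (f : V -> W) (z : V) :
  smooth_on U f -> U z -> differentiable f z.
Proof. by move=> /(_ 1) [+ _]; apply. Qed.

Lemma differential_approximation (R : realType) (V W : normedModType R)
    (f : V -> W) (u : V) (e : R) :
  differentiable f u -> 0 < e ->
  \forall w \near 0, `|f (u + w) - f u - 'd f u w| <= e * `|w|.
Proof.
move=> df e0; have /eqaddoP /(_ e e0) := diff_locally df.
apply: filterS => w /=; rewrite /cst /= => le.
by rewrite [u + w]addrC -addrA -opprD.
Qed.

(** * A compactness estimate *)

(** The minimum of g on the unit sphere of L is a valid delta. *)
Lemma positive_homogeneous_lower_bound (R : realType) (m : nat)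
    (L : set 'rV[R]_m) (g : 'rV[R]_m -> R) :
  closed L -> (forall t w, L w -> L (t *: w)) -> continuous g ->
  (forall t w, 0 <= t -> g (t *: w) = t * g w) ->
  (forall w, L w -> w != 0 -> 0 < g w) ->
  exists2 delta, 0 < delta & forall w, L w -> delta * `|w| <= g w.
Proof.
move=> Lcl LZ gC gZ g_gt0; pose A := L `&` [set w | `|w| = 1].
have g0 : g 0 = 0 by rewrite -(scale0r (0 : 'rV[R]_m)) gZ // mul0r.
have normalize w : L w -> w != 0 -> A (`|w|^-1 *: w).
  move=> Lw w0; split; first exact: LZ.
  by rewrite /= normrZ normfV normr_id mulVf ?normr_eq0.
have [A0|/nonemptyPn A0] := pselect (A !=set0); last first.
  (* The sphere is empty only if L contains no nonzero vector. *)
  exists 1 => // w Lw; have [->|w0] := eqVneq w 0; first by rewrite normr0 mulr0 g0.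
  by have := normalize w Lw w0; rewrite A0.
have cA : compact A.
  apply: bounded_closed_compact.
    exists 1; split; first exact: real1.
    by move=> M M1 w [_ /= ->]; exact: ltW.
  apply: closedI => //.
  move: (@norm_continuous _ 'rV[R]_m) => /continuous_closedP /(_ [set 1]); apply.
  exact: closed_eq.
have [c /set_mem [Lc c1] cmin] := EVT_min_rV A0 cA (continuous_subspaceT gC).
have c0 : c != 0 by rewrite -normr_eq0 c1 oner_eq0.
exists (g c) => [|w Lw]; first exact: g_gt0.
have [->|w0] := eqVneq w 0; first by rewrite normr0 mulr0 g0.
have := cmin _ (mem_set (normalize w Lw w0)).
by rewrite gZ ?invr_ge0 // mulrC ler_pdivlMr ?normr_gt0.
Qed.

(** * Polyhedra near a point *)

Definition dot (R : realType) (m : nat) (a z : 'rV[R]_m) : R :=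
  \sum_(i < m) a ord0 i * z ord0 i.

Lemma dotD (R : realType) (m : nat) (a y z : 'rV[R]_m) :
  dot a (y + z) = dot a y + dot a z.
Proof.
by rewrite /dot -big_split; apply: eq_bigr => i _; rewrite mxE mulrDr.
Qed.

Lemma dotZ (R : realType) (m : nat) (a z : 'rV[R]_m) (t : R) :
  dot a (t *: z) = t * dot a z.
Proof.
by rewrite /dot mulr_sumr; apply: eq_bigr => i _; rewrite mxE mulrCA.
Qed.

Lemma dot_continuous (R : realType) (m : nat) (a : 'rV[R]_m) :
  continuous (dot a).
Proof.
apply: continuous_big => [p|i _ z]; first exact: add_continuous.
apply: (@continuousM _ _ (cst (a ord0 i)) (fun z : 'rV[R]_m => z ord0 i)).
  exact: cst_continuous.
exact: coord_continuous.
Qed.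

(** The norm on row vectors is the sup norm, hence the l1 norm of a. *)
Lemma le_dot_norm (R : realType) (m : nat) (a z : 'rV[R]_m) :
  `|dot a z| <= (\sum_(i < m) `|a ord0 i|) * `|z|.
Proof.
rewrite mulr_suml; apply: le_trans (ler_norm_sum _ _ _) _.
apply: ler_sum => i _; rewrite normrM ler_wpM2l //.
by rewrite [leRHS]mx_normrE; exact: (le_bigmax _ (fun ij => `|z ij.1 ij.2|) (ord0, i)).
Qed.

Lemma finite_intersection_of_halfspacesP (R : realType) (m : nat)
    (P : set 'rV[R]_m) :
  finite_intersection_of_halfspaces P ->
  exists (k : nat) (a : 'I_k -> 'rV[R]_m) (b : 'I_k -> R),
    forall z, P z <-> forall i, dot (a i) z <= b i.
Proof.
move=> [k [H [Hhs ->]]].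
have /choice[a /choice[b Hab]] : forall i, exists a b,
    H i = [set z | dot a z <= b].
  by move=> i; have [a [b [_ ->]]] := Hhs i; exists a, b.
exists k, a, b => z; split=> [Hz i|abz i _]; last by rewrite Hab; exact: abz.
by have := Hz i I; rewrite Hab.
Qed.

(** The positive parts of the active constraints are summed, rather than their
    maximum taken, so that the formula makes sense when no constraint is
    active. The excess vanishes exactly on the cone of directions along which
    the polyhedron {z | a_i . z <= b_i} continues from its point x. *)
Definition active_excess (R : realType) (m k : nat) (a : 'I_k -> 'rV[R]_m)
    (b : 'I_k -> R) (x h : 'rV[R]_m) : R :=
  \sum_(i < k | dot (a i) x == b i) Num.max (dot (a i) h) 0.

Lemma active_excess_continuous (R : realType) (m k : nat)
    (a : 'I_k -> 'rV[R]_m) (b : 'I_k -> R) (x : 'rV[R]_m) :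
  continuous (active_excess a b x).
Proof.
apply: continuous_big => [p|i _ z]; first exact: add_continuous.
apply: (@continuous_max _ _ (dot (a i)) (cst 0)); first exact: dot_continuous.
exact: cst_continuous.
Qed.

Lemma active_excessZ (R : realType) (m k : nat) (a : 'I_k -> 'rV[R]_m)
    (b : 'I_k -> R) (x h : 'rV[R]_m) (t : R) :
  0 <= t -> active_excess a b x (t *: h) = t * active_excess a b x h.
Proof.
move=> t0; rewrite /active_excess mulr_sumr; apply: eq_bigr => i _.
by rewrite dotZ maxr_pMr // mulr0.
Qed.

Lemma active_excess_le0 (R : realType) (m k : nat) (a : 'I_k -> 'rV[R]_m)
    (b : 'I_k -> R) (x h : 'rV[R]_m) :
  active_excess a b x h <= 0 ->
  forall i, dot (a i) x = b i -> dot (a i) h <= 0.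
Proof.
move=> e0 i /eqP act; apply: le_trans e0.
rewrite /active_excess (bigD1 i) //=.
apply: (@le_trans _ _ (Num.max (dot (a i) h) 0)).
  by rewrite le_max lexx.
by rewrite lerDl sumr_ge0 // => j _; rewrite le_max lexx orbT.
Qed.

(** Constraints active at x are preserved along h by hypothesis; the others
    have slack at x and survive a short step by continuity. There are finitely
    many of them, so one step length suits all. *)
Lemma feasible_step (R : realType) (m k : nat) (a : 'I_k -> 'rV[R]_m)
    (b : 'I_k -> R) (x h : 'rV[R]_m) :
  (forall i, dot (a i) x <= b i) ->
  (forall i, dot (a i) x = b i -> dot (a i) h <= 0) ->
  exists2 t : R, 0 < t & forall i, dot (a i) (x + t *: h) <= b i.
Proof.
move=> Px dec.
suff : \forall t \near 0^'+, forall i, dot (a i) (x + t *: h) <= b i.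
  move=> near_feasible; near (0 : R)^'+ => t.
  by exists t; [near: t; exact: nbhs_right_gt|exact: (near near_feasible t)].
apply: filter_forall => i; have := Px i.
rewrite le_eqVlt => /predU1P[act|slack].
  apply: filterS (nbhs_right_ge 0) => t t0.
  by rewrite dotD dotZ act gerDl mulr_ge0_le0 ?dec.
have cont : {for 0, continuous (fun t : R => dot (a i) (x + t *: h))}.
  apply: (@continuous_comp _ _ _ (fun t : R => x + t *: h)).
    exact: differentiable_continuous.
  exact: dot_continuous.
have to_x : dot (a i) (x + t *: h) @[t --> 0^'+] --> dot (a i) x.
  by have := cvg_at_right_filter cont; rewrite scale0r addr0.
by apply: filterS (cvgr_lt _ to_x _ slack) => t /ltW.
Unshelve. all: by end_near. Qed.

(** If the displacement h + r keeps all the constraints, an active one satisfies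
    a_i . h <= - a_i . r, so an increase along h is paid for by the error r. *)
Lemma active_excess_le_error (R : realType) (m k : nat)
    (a : 'I_k -> 'rV[R]_m) (b : 'I_k -> R) (x h r : 'rV[R]_m) :
  (forall i, dot (a i) (x + h + r) <= b i) ->
  active_excess a b x h <=
    (\sum_(i < k) \sum_(j < m) `|a i ord0 j|) * `|r|.
Proof.
move=> Py; rewrite /active_excess mulr_suml big_mkcond ler_sum // => i _.
have nonneg : 0 <= (\sum_(j < m) `|a i ord0 j|) * `|r|.
  by rewrite mulr_ge0 // sumr_ge0.
case: ifPn => // /eqP act; rewrite ge_max nonneg andbT.
apply: le_trans (le_dot_norm _ _); rewrite -normrN.
apply: le_trans (ler_norm _).
by have := Py i; rewrite !dotD act -addrA gerDl -lerBrDr sub0r.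
Qed.

(** * Tangent directions from a slice chart *)

Definition slice (R : realType) (m d : nat) : set 'rV[R]_m :=
  [set w | forall i : 'I_m, (d <= i)%N -> w ord0 i = 0].

Lemma slice_linear (R : realType) (m d : nat) (v w : 'rV[R]_m) (t : R) :
  slice d v -> slice d w -> slice d (v + t *: w).
Proof. by move=> Sv Sw i di; rewrite !mxE Sv // Sw // mulr0 addr0. Qed.

Lemma slice_scale (R : realType) (m d : nat) (w : 'rV[R]_m) (t : R) :
  slice d w -> slice d (t *: w).
Proof. by move=> Sw i di; rewrite mxE Sw // mulr0. Qed.

Lemma slice_closed (R : realType) (m d : nat) : closed (@slice R m d).
Proof.
rewrite (_ : slice d = \bigcap_(i in [set i : 'I_m | (d <= i)%N])
    ((fun w : 'rV[R]_m => w ord0 i) @^-1` [set 0])); last first.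
  by [].
apply: closed_bigI => i _.
have /continuous_closedP := @coord_continuous R 1 m ord0 i; apply.
exact: closed_eq.
Qed.

(** The image under psi of the line phi x + t w, which stays in the slice, is a
    smooth curve in M with velocity d psi w at time 0. *)
Lemma slice_direction_tangent (R : realType) (m d : nat)
    (M U V : set 'rV[R]_m) (phi psi : 'rV[R]_m -> 'rV[R]_m)
    (x w : 'rV[R]_m) :
  diffeomorphism U V phi psi ->
  (forall z, U z -> (M z <-> slice d (phi z))) ->
  U x -> M x -> slice d w ->
  tangent_space M x ('d psi (phi x) w).
Proof.
move=> [[_ oV] UV VU _ psi_smooth] MU Ux Mx Sw.
have [Vx xK] := UV _ Ux.
have line_in_V : \forall t \near (0 : R), V (phi x + t *: w).
  have cont : {for 0, continuous (fun t : R => phi x + t *: w)}.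
    exact: differentiable_continuous.
  by apply: cont; rewrite scale0r addr0; exact: open_nbhs_nbhs.
have [e /= e0 eV] := line_in_V.
have IV t : t \in `]- e, e[ -> V (phi x + t *: w).
  move=> te; apply: eV; rewrite /= sub0r normrN ltr_norml.
  by move: te; rewrite in_itv.
exists e, (fun t => psi (phi x + t *: w)); split=> //.
- by move=> k; apply: (Ck_on_line IV).
- move=> t /IV /VU [Uz zK]; apply/(MU _ Uz); rewrite zK.
  by apply: slice_linear => //; apply/(MU _ Ux).
- by rewrite scale0r addr0.
- rewrite derive1E derive_line scale1r scale0r addr0 deriveE //.
  exact: smooth_differentiable psi_smooth Vx.
Qed.

(** * The minimizer *)

Theorem theorem11 (R : realType) (m : nat) (f : 'rV[R]_m -> R)
    (M : set 'rV[R]_m) (x : 'rV[R]_m) :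
  polytopic f ->
  embedded_submanifold M ->
  M x ->
  unique_minimizer f [set z | tangent_space M x (z - x)] x ->
  strong_local_minimizer f M x.
Proof.
move=> fpoly [d _ charts] Mx [[_ xmin] xuniq].
have [U [V [phi [psi [Ux chart MU]]]]] := charts x Mx.
have [[oU oV] UV VU phi_smooth psi_smooth] := chart.
have [Vx xK] := UV _ Ux.
have [k [a [b Pab]]] := finite_intersection_of_halfspacesP (fpoly (f x)).
have dphi := smooth_differentiable phi_smooth Ux.
have dpsi := smooth_differentiable psi_smooth Vx.
pose A := 'd psi (phi x).
have A_inj w : A w = 0 -> w = 0.
  have AK : 'd phi (psi (phi x)) (A w) = w.
    apply: diff_left_inverse => //; first by rewrite xK.
    have : nbhs (phi x) V by exact: open_nbhs_nbhs.
    by apply: filterS => z /VU [].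
  by move=> Aw; rewrite -AK (congr1 ('d phi _) Aw); exact: linear0.
have Px : forall i, dot (a i) x <= b i by apply/Pab => /=.
have excess_gt0 w : slice d w -> w != 0 -> 0 < active_excess a b x (A w).
  move=> Sw w0; rewrite ltNge; apply/negP => /active_excess_le0 dec.
  have [t t0 Pt] := feasible_step Px dec.
  have fle : f (x + t *: A w) <= f x by apply/Pab.
  have : x + t *: A w = x.
    apply: xuniq; split=> [|z Tz]; last exact: le_trans fle (xmin _ Tz).
    rewrite /= addrC addKr -linearZ.
    by apply: (slice_direction_tangent chart MU) => //; exact: slice_scale.
  move=> /(canRL (addKr _)); rewrite addNr => /eqP.
  rewrite scaler_eq0 gt_eqF //= => /eqP /A_inj.
  exact/eqP.
have [delta delta0 excess_ge] : exists2 delta, 0 < delta &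
    forall w, slice d w -> delta * `|w| <= active_excess a b x (A w).
  apply: positive_homogeneous_lower_bound excess_gt0.
  - exact: slice_closed.
  - by move=> t w; exact: slice_scale.
  - move=> w; apply: continuous_comp; first exact: diff_continuous.
    exact: active_excess_continuous.
  - by move=> t w t0; rewrite linearZ active_excessZ.
(* C bounds the excess caused by an error of unit norm; an error of at most
   delta / (C + 1) times the norm of w then costs less than delta times it. *)
pose C := \sum_(i < k) \sum_(j < m) `|a i ord0 j|.
have C0 : 0 <= C by do 2![apply: sumr_ge0 => ? _].
have e0 : 0 < delta / (C + 1) by rewrite divr_gt0 // ltr_wpDl.
have near_x : \forall y \near x, U y /\
    `|y - x - A (phi y - phi x)| <= delta / (C + 1) * `|phi y - phi x|.
  have Unear : \forall y \near x, U y by exact: open_nbhs_nbhs.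
  have /subr_cvg0 to0 := differentiable_continuous dphi.
  apply: filterS2 Unear (to0 _ (differential_approximation dpsi e0)) => y Uy.
  by rewrite /= [phi x + _]addrC subrK (UV _ Uy).2 xK.
split=> //; eexists; first exact: near_x.
move=> y My [Uy]; set w := phi y - phi x => approx yx.
rewrite ltNge; apply/negP => /Pab Py; apply: yx.
have Sw : slice d w.
  rewrite /w -scaleN1r.
  by apply: slice_linear; [exact/(MU _ Uy)|exact/(MU _ Ux)].
have yE : y = x + A w + (y - x - A w).
  by rewrite [RHS]addrC -[y - x - A w]addrA -opprD subrK.
rewrite yE in Py.
have bound : delta * `|w| <= C * (delta / (C + 1) * `|w|).
  apply: le_trans (excess_ge _ Sw) (le_trans (active_excess_le_error Py) _).
  exact: ler_wpM2l.
have w0 : w = 0.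
  apply/eqP; rewrite -normr_le0 leNgt; apply/negP => w_gt0.
  move: bound; rewrite mulrA ler_pM2r // mulrCA ler_pMr //.
  by rewrite ler_pdivlMr ?ltr_wpDl // mul1r gerDl ler10.
by rewrite -(UV _ Uy).2 -xK; congr psi; apply/eqP; rewrite -subr_eq0 -/w w0.
Qed.
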